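(* Let $G$ be a Hausdorff topological group which is FSIN. If for some integer $p\ge 2$ there is a nonempty open subset $\Omega$ of $G$ such that the restriction to $\Omega$ of the power map, $\Omega\ni g\mapsto g^p\in G$, is left uniformly continuous, then $G$ is SIN.
   Context: Let $e$ be the unit of $G$ and $\mathcal N(e)$ the set of all neighborhoods of $e$ in $G$. The left uniformity $\mathcal U_l$ of $G$ has as a basis of entourages the sets $\{(x,y)\in G\times G: x^{-1}y\in V\}$, $V\in\mathcal N(e)$; the right uniformity $\mathcal U_r$ has as a basis of entourages the sets $\{(x,y)\in G\times G: xy^{-1}\in V\}$, $V\in\mathcal N(e)$. $G$ is SIN if $\mathcal U_l=\mathcal U_r$. A function $f:G\to\mathbb R$ is left (right) uniformly continuous if it is uniformly continuous when $G$ is equipped with $\mathcal U_l$ (with $\mathcal U_r$) and $\mathbb R$ with its usual metric. $G$ is FSIN if every bounded left uniformly continuous function $f:G\to\mathbb R$ is right uniformly continuous. A map $f:\Omega\to G$ with $\Omega\subset G$ is left uniformly continuous if it is uniformly continuous when $\Omega$ carries the uniformity induced by $\mathcal U_l$ and $G$ carries $\mathcal U_l$; i.e. for every $V\in\mathcal N(e)$ there is $W\in\mathcal N(e)$ such that $f(x)^{-1}f(y)\in V$ whenever $x,y\in\Omega$ and $x^{-1}y\in W$. *)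

(* Defs.v *)
From HB Require Import structures.
From mathcomp Require Import all_boot all_algebra.
From mathcomp Require Import all_classical all_reals all_analysis.
Import numFieldNormedType.Exports.

Set Implicit Arguments.
Unset Strict Implicit.
Unset Printing Implicit Defensive.

Local Open Scope classical_set_scope.
Local Open Scope group_scope.

HB.mixin Record Topological_isTopologicalGroup G & Topological G & Group G := {
  mulg_continuous : continuous (fun x : G * G => x.1 * x.2);
  invg_continuous : continuous (fun x : G => x^-1)
}.

#[short(type="topologicalGroupType")]
HB.structure Definition TopologicalGroup :=
  {G of Topological G & Group G & Topological_isTopologicalGroup G}.

Section UniformStructures.
Variable G : topologicalGroupType.
Implicit Types (A : set (G * G)) (V : set G) (x y : G).

Definition left_entourage : set_system (G * G) :=
  filter_from (nbhs (1 : G)) (fun V => [set xy | V (xy.1^-1 * xy.2)]).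

Definition right_entourage : set_system (G * G) :=
  filter_from (nbhs (1 : G)) (fun V => [set xy | V (xy.1 * xy.2^-1)]).

Lemma cvg_mulg (T : Type) (F : set_system T) (f g : T -> G) a b :
  Filter F -> f @ F --> a -> g @ F --> b -> (fun t => f t * g t) @ F --> a * b.
Proof.
move=> FF fa gb.
exact: (@cvg_comp _ _ _ (fun t => (f t, g t)) (fun z : G * G => z.1 * z.2)
  _ _ _ (cvg_pair fa gb) (@mulg_continuous G (a, b))).
Qed.

Lemma nbhs1_split V : nbhs (1 : G) V ->
  exists2 W, nbhs (1 : G) W & forall x y, W x -> W y -> V (x * y).
Proof.
move=> V1.
have : nbhs ((1, 1) : G * G) [set z | V (z.1 * z.2)].
  by apply: (@mulg_continuous G (1, 1)); rewrite /= mulg1.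
case=> -[B C] /= [B1 C1] BCV; exists (B `&` C); first exact: filterI.
by move=> x y [Bx _] [_ Cy]; apply: (BCV (x, y)).
Qed.

Lemma nbhs1_inv V : nbhs (1 : G) V -> nbhs (1 : G) [set x | V x^-1].
Proof. by move=> V1; apply: (@invg_continuous G 1); rewrite invg1. Qed.

Lemma left_entourage_filter : Filter left_entourage.
Proof.
apply: filter_from_filter; first by exists setT; exact: filterT.
by move=> V W V1 W1; exists (V `&` W); [exact: filterI|].
Qed.

Lemma left_entourage_diagonal A : left_entourage A -> diagonal `<=` A.
Proof.
move=> [V V1 VA] [x y] /diagonalP ->; apply: VA => /=.
by rewrite mulVg; exact: nbhs_singleton.
Qed.

Lemma left_entourage_inv A : left_entourage A -> left_entourage (A^-1)%relation.
Proof.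
move=> [V V1 VA]; exists [set x | V x^-1]; first exact: nbhs1_inv.
by move=> [x y] /=; rewrite invgM invgK => Vyx; apply: (VA (y, x)).
Qed.

Lemma left_entourage_split A : left_entourage A ->
  exists2 B, left_entourage B & (B \; B `<=` A)%relation.
Proof.
move=> [V /nbhs1_split[W W1 WV] VA].
exists [set xy | W (xy.1^-1 * xy.2)]; first by exists W.
move=> [x z] [y /= Wxy Wyz]; apply: VA => /=.
by have := WV _ _ Wxy Wyz; rewrite -mulgA mulVKg.
Qed.

Lemma left_entourage_nbhs : nbhs = nbhs_ left_entourage :> (G -> _).
Proof.
apply/funext => x; apply/seteqP; split=> U.
  move=> Ux; exists [set xy | U (x * (xy.1^-1 * xy.2))]; last first.
    by move=> y; rewrite /xsection /= inE /= mulVKg.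
  exists [set z | U (x * z)]; last by [].
  have : (fun z => x * z) @ (1 : G) --> x * 1.
    by apply: (@cvg_mulg _ _ (fun=> _) id); [exact: cvg_cst|exact: cvg_id].
  by rewrite mulg1; apply.
move=> [A [V V1 VA] AU].
have xV : (fun y => x^-1 * y) @ x --> (1 : G).
  rewrite -[X in _ --> X](mulVg x).
  by apply: (@cvg_mulg _ _ (fun=> _) id); [exact: cvg_cst|exact: cvg_id].
move: (xV _ V1); rewrite /= /nbhs /=; apply: filterS => y Vy; apply: AU.
by rewrite /xsection /= inE; exact: VA.
Qed.

Lemma right_entourage_filter : Filter right_entourage.
Proof.
apply: filter_from_filter; first by exists setT; exact: filterT.
by move=> V W V1 W1; exists (V `&` W); [exact: filterI|].
Qed.

Lemma right_entourage_diagonal A : right_entourage A -> diagonal `<=` A.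
Proof.
move=> [V V1 VA] [x y] /diagonalP ->; apply: VA => /=.
by rewrite mulgV; exact: nbhs_singleton.
Qed.

Lemma right_entourage_inv A :
  right_entourage A -> right_entourage (A^-1)%relation.
Proof.
move=> [V V1 VA]; exists [set x | V x^-1]; first exact: nbhs1_inv.
by move=> [x y] /=; rewrite invgM invgK => Vyx; apply: (VA (y, x)).
Qed.

Lemma right_entourage_split A : right_entourage A ->
  exists2 B, right_entourage B & (B \; B `<=` A)%relation.
Proof.
move=> [V /nbhs1_split[W W1 WV] VA].
exists [set xy | W (xy.1 * xy.2^-1)]; first by exists W.
move=> [x z] [y /= Wxy Wyz]; apply: VA => /=.
by have := WV _ _ Wxy Wyz; rewrite mulgA mulgVK.
Qed.

Lemma right_entourage_nbhs : nbhs = nbhs_ right_entourage :> (G -> _).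
Proof.
apply/funext => x; apply/seteqP; split=> U.
  move=> Ux; exists [set xy | U ((xy.1 * xy.2^-1)^-1 * x)]; last first.
    by move=> y; rewrite /xsection /= inE /= invgM invgK mulgVK.
  exists [set z | U (z^-1 * x)]; last by [].
  have : (fun z => z^-1 * x) @ (1 : G) --> 1^-1 * x.
    by apply: (@cvg_mulg _ _ (fun z => z^-1) (fun=> x));
      [exact: (@invg_continuous G)|exact: cvg_cst].
  by rewrite invg1 mul1g; apply.
move=> [A [V V1 VA] AU].
have xV : (fun y => x * y^-1) @ x --> (1 : G).
  rewrite -[X in _ --> X](mulgV x).
  by apply: (@cvg_mulg _ _ (fun=> x) (fun y => y^-1));
    [exact: cvg_cst|exact: (@invg_continuous G)].
move: (xV _ V1); rewrite /= /nbhs /=; apply: filterS => y Vy; apply: AU.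
by rewrite /xsection /= inE; exact: VA.
Qed.

(* Type aliases, so that [G] can carry two uniformities at once. Both are      *)
(* compatible with the given topology of [G].                                  *)
Definition left_uniform : Type := G.
Definition right_uniform : Type := G.

HB.instance Definition _ := Topological.copy left_uniform G.
HB.instance Definition _ := Nbhs_isUniform_mixin.Build left_uniform
  left_entourage_filter left_entourage_diagonal left_entourage_inv
  left_entourage_split left_entourage_nbhs.

HB.instance Definition _ := Topological.copy right_uniform G.
HB.instance Definition _ := Nbhs_isUniform_mixin.Build right_uniform
  right_entourage_filter right_entourage_diagonal right_entourage_inv
  right_entourage_split right_entourage_nbhs.

End UniformStructures.

Definition SIN (G : topologicalGroupType) : Prop :=
  @entourage (left_uniform G) = @entourage (right_uniform G).

Definition left_unif_continuous (R : realType) (G : topologicalGroupType)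
    (f : G -> R) : Prop :=
  unif_continuous (f : left_uniform G -> R).

Definition right_unif_continuous (R : realType) (G : topologicalGroupType)
    (f : G -> R) : Prop :=
  unif_continuous (f : right_uniform G -> R).

Definition FSIN (R : realType) (G : topologicalGroupType) : Prop :=
  forall f : G -> R, bounded_fun f ->
    left_unif_continuous f -> right_unif_continuous f.

(* The subtype [set_type Omega] carries the uniformity induced by the left     *)
(* uniformity of [G].                                                          *)
Definition left_unif_continuous_on (G : topologicalGroupType)
    (Omega : set G) (f : G -> G) : Prop :=
  unif_continuous (fun x : set_type (Omega : set (left_uniform G)) =>
    f (set_val x) : left_uniform G).

(* Main.v *)
(* The power map enters through the following observation. In G/V, suppose that
   h fixes the points t g V, ..., t^(p-1) g V of the orbit of g V under t. Then
   (h t)^p g V = h t^p g V, while (h t)^g = t^g (h^(t g)) is close to t^g for the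
   left uniformity, so that uniform continuity of the power map gives
   (h t)^p g V = t^p g V; thus h fixes the end point z V = t^p g V as well.
   FSIN says that for every subset A and every neighborhood V of 1 there is a
   neighborhood U of 1 with U A contained in A V. Applied to maximal separated
   sets A, it yields, for every U and W, a single neighborhood H of 1 such that
   each z has a translate u z, u in U, with H^(u z) contained in W. Going
   backwards from an arbitrary z near a^p (a in Omega), p - 1 such translations
   modify t, staying near a, so that a fixed neighborhood H almost fixes all
   the intermediate points of the orbit ending at z. Hence H^z is small
   uniformly in z near a^p, and one more translation argument extends this to
   all z in G. *)
Require Import Defs.
From mathcomp Require Import all_boot all_order all_algebra.
From mathcomp Require Import all_classical all_reals all_analysis.
Import Order.TTheory GRing.Theory Num.Theory.
Import numFieldNormedType.Exports.

Set Implicit Arguments.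
Unset Strict Implicit.
Unset Printing Implicit Defensive.

Local Open Scope classical_set_scope.

(** * Separating functions and maximal separated sets *)

Local Open Scope ring_scope.

(** [f] is the distance to [A] in the pseudometric of the gauge of [E]; balls of radius 2 are the
    whole space, so [f] is finite and bounded. *)
Lemma unif_continuous_separation (R : realType) (T : uniformType)
    (A : set T) (E : set (T * T)) : entourage E -> A !=set0 ->
  exists2 f : T -> R, bounded_fun f /\ unif_continuous f &
    (forall a, A a -> f a = 0) /\
    exists2 e : R, 0 < e & forall x, f x < e -> exists2 a, A a & E (x, a).
Proof.
move=> entE [a0 Aa0].
pose T' : pseudoMetricType R := gauge.type entE.
have dfin x : @edist_inf R T' A x \is a fin_num.
  rewrite ge0_fin_numE ?edist_inf_ge0//.
  apply: le_lt_trans; first by apply: ereal_inf_lbound; exists a0.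
  rewrite -ge0_fin_numE ?edist_ge0//; apply/edist_finP => /=; exists 2 => //.
  exact: countable_uniform.countable_uniform_bounded.
have le2 x : (@edist_inf R T' A x <= 2%:E)%E.
  apply: le_trans; first by apply: ereal_inf_lbound; exists a0.
  apply: edist_fin => //; exact: countable_uniform.countable_uniform_bounded.
pose f x := fine (@edist_inf R T' A x).
have f_lip (r : R) (x y : T') : 0 < r -> ball x r y -> f x <= r + f y.
  move=> r0 xy; rewrite -lee_fin EFinD !fineK//.
  apply: le_trans (edist_inf_triangle _ _ y) _.
  by rewrite leeD2r// edist_fin.
have ballE (r : R) : 0 < r -> entourage [set xy : T * T | ball (xy.1 : T') r xy.2].
  move=> r0; apply: (gauge.gauge_ent entE).
  have : @entourage T' [set xy | ball xy.1 r xy.2].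
    by rewrite -entourage_ballE; exists r.
  exact.
exists f; split.
- exists 2; split; first exact: num_real.
  move=> M M2 x _ /=; rewrite ger0_norm ?fine_ge0 ?edist_inf_ge0//.
  by rewrite (le_trans _ (ltW M2))// -lee_fin fineK.
- move=> B; rewrite -entourage_ballE => -[r /= r0 rB].
  have r20 : 0 < r / 2 by rewrite divr_gt0.
  rewrite nbhs_simpl /=; apply: filterS (ballE _ r20) => -[x y] /= xy.
  apply: rB => /=; rewrite /ball /= (le_lt_trans _ (_ : r / 2 < r))//.
    rewrite ler_distl lerBlDr ![_ + r / 2]addrC.
    by rewrite (f_lip _ _ _ r20 xy) (f_lip _ _ _ r20 (ball_sym xy)).
  by rewrite ltr_pdivrMr// ltr_pMr// ltr1n.
- by move=> a Aa; rewrite /f edist_inf0.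
- have : @entourage T' E by exists O => //=; move=> ? [].
  rewrite -entourage_ballE => -[e /= e0 eE]; exists e => // x.
  rewrite -lte_fin fineK// => /ereal_inf_lt[_ [a Aa <-]] /edist_lt_ball xa.
  by exists a => //; apply: eE.
Qed.

Local Close Scope ring_scope.
Local Open Scope group_scope.

Lemma maximal_separated (T : Type) (r : T -> T -> Prop) :
  (forall x, r x x) -> (forall x y, r x y -> r y x) ->
  exists A : set T, (forall a b, A a -> A b -> r a b -> a = b) /\
    forall z, exists2 a, A a & r a z.
Proof.
move=> rr rC.
pose P A := forall a b : T, A a -> A b -> r a b -> a = b.
have [F FP Ftot|A [PA Amax]] := @Zorn_bigcup T P.
  move=> a b [X FX Xa] [Y FY Yb].
  by have [XY|YX] := Ftot _ _ FX FY;
    [apply: (FP _ FY) => //; exact: XY|apply: (FP _ FX) => //; exact: YX].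
exists A; split => // z; apply: contrapT => zA.
apply: (Amax (A `|` [set z])).
  split; first exact: subsetUl.
  by move=> /(_ z (or_intror erefl)) Az; apply: zA; exists z.
move=> a b [Aa|->] [Ab|->] // rab; first exact: PA.
- by case: zA; exists a.
- by case: zA; exists b => //; exact: rC.
Qed.

(** * Conjugation and perturbed orbits in topological groups *)

Section TopologicalGroupNbhs.
Variable G : topologicalGroupType.
Implicit Types (U V W : set G) (g h x y z : G).

Lemma nbhs1_sym V : nbhs (1 : G) V -> exists W,
  [/\ nbhs (1 : G) W, forall x, W x -> W x^-1 & W `<=` V].
Proof.
move=> V1; exists (V `&` [set x | V x^-1]); split.
- by apply: filterI => //; exact: nbhs1_inv.
- by move=> x [Vx Vx'] /=; rewrite invgK.
- exact: subIsetl.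
Qed.

Lemma nbhs1_conj V x : nbhs (1 : G) V -> nbhs (1 : G) [set h | V (h ^ x)].
Proof.
move=> V1.
have : (fun h : G => x^-1 * (h * x)) @ (1 : G) --> x^-1 * (1 * x).
  apply: (@cvg_mulg _ _ _ (fun=> _)); first exact: cvg_cst.
  by apply: (@cvg_mulg _ _ _ id (fun=> _)); [exact: cvg_id|exact: cvg_cst].
by rewrite mul1g mulVg; apply.
Qed.

Lemma nbhs1_conj_uniform V : nbhs (1 : G) V -> exists2 W, nbhs (1 : G) W &
  forall h x, W h -> W x -> V (h ^ x).
Proof.
move=> V1.
have : (fun q : G * G => q.2^-1 * (q.1 * q.2)) @ ((1, 1) : G * G)
    --> 1^-1 * (1 * 1 : G).
  apply: cvg_mulg; last apply: cvg_mulg; last exact: cvg_snd; last exact: cvg_fst.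
  apply: (@cvg_comp _ _ _ (snd : G * G -> G) (fun x => x^-1)); first exact: cvg_snd.
  exact: invg_continuous.
rewrite mulg1 invg1 mulg1 => /(_ V V1)[[B C] /= [B1 C1] BCV].
exists (B `&` C); first exact: filterI.
by move=> h x [Bh _] [_ Cx]; exact: (BCV (h, x)).
Qed.

(* Left multiplication does not affect left closeness, so that the error made
   at each step is only multiplied on the right. *)
Lemma orbit_perturbation n V : nbhs (1 : G) V -> exists2 W, nbhs (1 : G) W &
  forall h s z, (forall j, (0 < j <= n)%N -> W (h ^ (s ^+ j * z))) ->
  forall j, (j <= n)%N -> V ((s ^+ j * z)^-1 * ((h * s) ^+ j * z)).
Proof.
elim: n V => [|n IHn] V V1.
  exists setT; first exact: filterT.
  move=> h s z _ j; rewrite leqn0 => /eqP ->.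
  by rewrite !expg0 mulVg; exact: nbhs_singleton.
have [V' V'1 V'V] := nbhs1_split V1.
have [W W1 WP] := IHn _ V'1.
exists (W `&` V'); first exact: filterI.
move=> h s z Wh.
have {WP}WP j : (j <= n)%N -> V' ((s ^+ j * z)^-1 * ((h * s) ^+ j * z)).
  by apply: WP => i /andP[i0 ni]; apply: (Wh _ _).1; rewrite i0 leqW.
case=> [_|j jn].
  by rewrite !expg0 mulVg; exact: nbhs_singleton.
have [_ V'h] := Wh j.+1 jn.
have := V'V _ _ V'h (WP j jn).
rewrite /conjg !expgS !invgM !mulgA.
by rewrite !mulgK.
Qed.

(** [x^-1 * y] is the inverse of the conjugate of [x * y^-1] by [x], and symmetrically with
    [x^-1]. *)
Lemma SIN_conj : (forall V, nbhs (1 : G) V -> exists2 H, nbhs (1 : G) H &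
  forall h z, H h -> V (h ^ z)) -> SIN G.
Proof.
move=> thinG; apply/seteqP; split=> A [V V1 VA].
  have [H H1 HV] := thinG _ (nbhs1_inv V1); exists H => // -[x y] /= Hxy.
  apply: VA => /=; have := HV _ x Hxy.
  by rewrite /= /conjg !invgM !invgK !mulgA mulgVK.
have [H H1 HV] := thinG _ (nbhs1_inv V1); exists H => // -[x y] /= Hxy.
apply: VA => /=; have := HV _ x^-1 Hxy.
by rewrite /= /conjg !invgM !invgK !mulgA mulgK.
Qed.

Lemma left_unif_continuous_onP (Omega : set G) (f : G -> G) :
  left_unif_continuous_on Omega f -> forall V, nbhs (1 : G) V ->
  exists2 W, nbhs (1 : G) W &
    forall x y, Omega x -> Omega y -> W (x^-1 * y) -> V ((f x)^-1 * f y).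
Proof.
move=> fU V V1.
have /fU : @entourage (left_uniform G) [set xy | V (xy.1^-1 * xy.2)].
  by exists V.
case=> B /= [W W1 WB] BV; exists W => // x y Ox Oy Wxy.
by apply: (BV (exist _ x (mem_set Ox), exist _ y (mem_set Oy))); exact: WB.
Qed.

End TopologicalGroupNbhs.

Lemma cvg_expg (G : topologicalGroupType) (T : Type) (F : set_system T)
    (f : T -> G) a n :
  Filter F -> f @ F --> a -> (fun t => f t ^+ n) @ F --> a ^+ n.
Proof.
move=> FF fa; elim: n => [|n IHn]; first exact: cvg_cst.
rewrite expgS; under eq_fun do rewrite expgS.
exact: cvg_mulg.
Qed.

(** * Uniform control of conjugates in FSIN groups *)

Section FSINGroup.
Context {R : realType} {G : topologicalGroupType}.
Hypothesis G_FSIN : FSIN R G.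
Implicit Types (A U V W : set G) (g h x y z : G).

(** A bounded left uniformly continuous function that vanishes on [A] and is at least [e] off
    [A * V] is right uniformly continuous; since [u * a] is right close to [a], its value there is
    below [e]. *)
Lemma FSIN_mul_subset A V : nbhs (1 : G) V ->
  exists2 U, nbhs (1 : G) U &
    forall u a, U u -> A a -> exists2 b, A b & V (b^-1 * (u * a)).
Proof.
move=> V1; have [->|/set0P A0] := eqVneq A set0.
  by exists setT => //; exact: filterT.
have entV : @entourage (left_uniform G) [set xy | V (xy.2^-1 * xy.1)].
  exists [set x | V x^-1]; first exact: nbhs1_inv.
  by move=> [x y] /=; rewrite invgM invgK.
have [f [fb fU] [fA [e e0 fe]]] := unif_continuous_separation R entV A0.
have /(G_FSIN fb fU) : entourage [set xy : R * R | ball xy.1 e xy.2].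
  by rewrite -entourage_ballE; exists e.
case=> U U1 Uf; exists U => // u a Uu Aa.
have /Uf /= : U ((u * a, a).1 * (u * a, a).2^-1) by rewrite /= mulgK.
rewrite (fA _ Aa) /ball/= subr0 => /(le_lt_trans (ler_norm _)) /fe[b Ab Vb].
by exists b.
Qed.

(* Every [z] lies in [U * a * W] for some [a] in a maximal set [A] whose
   elements are pairwise separated by such products. Separation turns
   [H * A `<=` A * W] into [H * a `<=` a * W] for each [a] in [A]. *)
Lemma FSIN_conj_translate U W : nbhs (1 : G) U -> nbhs (1 : G) W ->
  exists2 H, nbhs (1 : G) H &
    forall z, exists2 u, U u & forall h, H h -> W (h ^ (u * z)).
Proof.
move=> /nbhs1_sym[U' [U'1 U'V U'U]] /nbhs1_conj_uniform[W1 W11 W1W].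
have [W' [W'1 W'V W'W]] := nbhs1_sym W11.
pose r x y := exists2 u, U' u & exists2 w, W' w & y = u * x * w.
have [||A [Asep Amax]] := @maximal_separated G r.
- move=> x; exists 1; first exact: nbhs_singleton.
  by exists 1; [exact: nbhs_singleton|rewrite mul1g mulg1].
- move=> x _ [u Uu [w Ww ->]]; exists u^-1; first exact: U'V.
  by exists w^-1; [exact: W'V|rewrite !mulgA mulVg mul1g mulgK].
have [H H1 HA] := FSIN_mul_subset A W'1.
exists (H `&` U'); first exact: filterI.
move=> z; have [a Aa [u Uu [w Ww ->]]] := Amax z.
exists u^-1; first exact/U'U/U'V.
move=> h [Hh U'h]; rewrite !mulgA mulVg mul1g conjgM.
apply: W1W; last exact: W'W.
have [b Ab Wb] := HA h a Hh Aa; apply: W'W.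
suff ab : a = b by move: Wb; rewrite -ab.
apply: Asep => //; exists h => //; exists (b^-1 * (h * a))^-1; first exact: W'V.
by rewrite !invgM invgK !mulgA !mulgK mulgV mul1g.
Qed.

(* Points of the orbit are moved one at a time by [FSIN_conj_translate]; the
   translation used for the next point is taken in the neighborhood that
   almost fixes the previous ones, so they do not move away. *)
Lemma FSIN_conj_orbit n U W : nbhs (1 : G) U -> nbhs (1 : G) W ->
  exists2 H, nbhs (1 : G) H &
    forall c z, exists2 k, U k &
      forall h j, H h -> (0 < j <= n)%N -> W (h ^ ((k * c) ^+ j * z)).
Proof.
elim: n U W => [|n IHn] U W U1 W1.
  exists setT; first exact: filterT.
  move=> c z; exists 1; first exact: nbhs_singleton.
  by move=> h [|j] // _ /andP[].
have [U' U'1 U'U] := nbhs1_split U1.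
have [W2 W21 W2W] := nbhs1_conj_uniform W1.
have [W3 W31 W3W2] := orbit_perturbation n W21.
have [H H1 HW] := IHn _ _ U'1 (filterI W31 W21).
have [H' H'1 H'W] := FSIN_conj_translate (filterI H1 U'1) W21.
exists (H `&` H'); first exact: filterI.
move=> c z; have [k U'k kW] := HW c z.
set s := k * c in kW.
have [u [Hu U'u] uW] := H'W (s ^+ n.+1 * z).
exists (u * k); first exact: U'U.
rewrite -mulgA -/s.
have us j : (j <= n)%N -> W2 ((s ^+ j * z)^-1 * ((u * s) ^+ j * z)).
  by apply: W3W2 => i /(kW _ _ Hu)[].
move=> h j [Hh H'h] /andP[j0]; rewrite leq_eqVlt => /predU1P[->|jn].
  (* The new point differs from [u * (s ^+ n.+1 * z)], which [h] almost fixes by the choice of [u],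
     only by the error already made at step [n]. *)
  have -> : (u * s) ^+ n.+1 * z =
      u * (s ^+ n.+1 * z) * ((s ^+ n * z)^-1 * ((u * s) ^+ n * z)).
    by rewrite !expgS !invgM !mulgA !mulgK.
  by rewrite conjgM; apply: W2W; [exact: uW|exact: us].
rewrite -(mulVKg (s ^+ j * z) ((u * s) ^+ j * z)) conjgM.
apply: W2W; last exact: us.
by apply: (kW _ _ Hh _).2; rewrite j0.
Qed.

(* [z] is the end of the orbit of [g = s ^+ p * z] under [t = s^-1], where [s]
   is a small perturbation of [a^-1] such that [h] almost fixes the points
   before [z]. Hence [(h * t) ^+ p * g] is close to [h * z]; it is also
   close to [t ^+ p * g = z] since [t ^ g] and [(h * t) ^ g] are close points
   of [Omega]. *)
Lemma FSIN_conj_near_power (Omega : set G) (a : G) p :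
  (2 <= p)%N -> nbhs a Omega ->
  left_unif_continuous_on Omega (fun g => g ^+ p) ->
  exists2 D, nbhs (a ^+ p) D & forall V, nbhs (1 : G) V ->
    exists2 H, nbhs (1 : G) H & forall h z, H h -> D z -> V (h ^ z).
Proof.
case: p => // n n0 a_Omega /left_unif_continuous_onP pU.
pose g k z : G := (k * a^-1) ^+ n.+1 * z.
have [U [D [U1 D1 UOm]]] : exists U D, [/\ nbhs (1 : G) U, nbhs (a ^+ n.+1) D &
    forall h k z, U h -> U k -> D z -> Omega ((h * (k * a^-1)^-1) ^ g k z)].
  (* For [h = k = 1] and [z = a ^+ n.+1] the orbit starts at [1], so the value is [a]; joint
     continuity does the rest. *)
  have : (fun q : G * G * G => (q.1.1 * (q.1.2 * a^-1)^-1) ^ g q.1.2 q.2)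
      @ ((1, 1, a ^+ n.+1) : G * G * G) --> a.
    have c1 : (fun q : G * G * G => q.1.1) @ ((1, 1, a ^+ n.+1) : G * G * G)
        --> (1 : G).
      by apply: (@cvg_comp _ _ _ fst fst); exact: cvg_fst.
    have c2 : (fun q : G * G * G => q.1.2 * a^-1)
        @ ((1, 1, a ^+ n.+1) : G * G * G) --> a^-1.
      rewrite -[X in _ --> X]mul1g; apply: cvg_mulg; last exact: cvg_cst.
      by apply: (@cvg_comp _ _ _ fst snd); [exact: cvg_fst|exact: cvg_snd].
    have cg : (fun q : G * G * G => g q.1.2 q.2)
        @ ((1, 1, a ^+ n.+1) : G * G * G) --> (1 : G).
      rewrite [X in _ --> X](_ : _ = a^-1 ^+ n.+1 * a ^+ n.+1); last first.
        by rewrite expVgn mulVg.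
      by apply: cvg_mulg; [exact: cvg_expg|exact: cvg_snd].
    have cV (f : G * G * G -> G) b : f @ ((1, 1, a ^+ n.+1) : G * G * G) --> b ->
        (fun q => (f q)^-1) @ ((1, 1, a ^+ n.+1) : G * G * G) --> b^-1.
      move=> fb; apply: (@cvg_comp _ _ _ f (fun x => x^-1) _ _ _ fb).
      exact: invg_continuous.
    rewrite -[X in _ --> X](_ : 1^-1 * (1 * a^-1^-1 * 1) = a); last first.
      by rewrite invg1 !mul1g mulg1 invgK.
    apply: cvg_mulg; first exact: cV.
    by apply: cvg_mulg => //; apply: cvg_mulg => //; exact: cV.
  move=> /(_ _ a_Omega)[[B D] /= [[[B1 B2] /= [B11 B21] BB] D1] BD].
  exists (B1 `&` B2), D; split => //; first exact: filterI.
  move=> h k z [B1h _] [_ B2k] Dz; apply: (BD (h, k, z)); split => //=.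
  exact: (BB (h, k)).
exists D => // V V1.
have [V' V'1 V'V] := nbhs1_split V1.
have [W0 W01 W0V] := pU _ V'1.
have [W2 W21 W2V] := orbit_perturbation n (nbhs1_inv V'1).
have [H H1 HW] := FSIN_conj_orbit n U1 (filterI W01 W21).
exists (H `&` U); first exact: filterI.
move=> h z [Hh Uh] Dz; have [k Uk kW] := HW a^-1 z.
have := UOm 1 k z (nbhs_singleton U1) Uk Dz; rewrite mul1g.
have := UOm h k z Uh Uk Dz.
set s := k * a^-1 in kW *.
move: (g k z) (erefl : s ^+ n.+1 * z = g k z) => {UOm}{}g gE Omy Omx.
have tg j : (j <= n.+1)%N -> s^-1 ^+ j * g = s ^+ (n.+1 - j) * z.
  by move=> jn; rewrite -gE -{1}(subnKC jn) expgnDr !mulgA expVgn mulVg mul1g.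
have /W2V -/(_ n (leqnn n)) : forall j, (0 < j <= n)%N ->
    W2 (h ^ (s^-1 ^+ j * g)).
  move=> j /andP[j0 jn]; rewrite tg; last exact: leqW.
  apply: (kW _ _ Hh _).2; rewrite subn_gt0 ltnS jn/=.
  by rewrite leq_subLR -add1n leq_add2r.
set w := _ * _ => V'w.
have := W0V _ _ Omx Omy.
have -> : (s^-1 ^ g)^-1 * (h * s^-1) ^ g = h ^ (s^-1 ^+ 1 * g).
  by rewrite expg1 /conjg !invgM !invgK !mulgA mulgK.
(* [0 < n], that is [2 <= p], puts the exponent in [s^-1 * g = s ^+ n * z] within the controlled
   range. *)
rewrite tg// subn1/= => /(_ (kW _ _ Hh _).1); rewrite (n0 : (0 < n)%N) leqnn => /(_ isT).
(* [w] is the error after [n] steps; as [w^-1] is in [V'], it can be cancelled on the right. *)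
have -> : ((s^-1 ^ g) ^+ n.+1)^-1 * ((h * s^-1) ^ g) ^+ n.+1 = h ^ z * w.
  rewrite -!conjXg -conjVg -conjMg.
  have -> : z = s^-1 ^+ n.+1 * g by rewrite tg// subnn expg0 mul1g.
  by rewrite /w /conjg !expgS !invgM !mulgA !mulgK.
by move=> /V'V /(_ V'w); rewrite mulgK.
Qed.

End FSINGroup.

Theorem corollary3p5 (R : realType) (G : topologicalGroupType)
    (G_hausdorff : hausdorff_space G) (G_FSIN : FSIN R G)
    (p : nat) (p_ge2 : (2 <= p)%N)
    (Omega : set G) (Omega_open : open Omega) (Omega_neq0 : Omega !=set0)
    (power_luc : left_unif_continuous_on Omega (fun g : G => g ^+ p)) :
  SIN G.
Proof.
have [a Oa] := Omega_neq0.
have [D aD DH] := FSIN_conj_near_power G_FSIN p_ge2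
  (open_nbhs_nbhs (conj Omega_open Oa)) power_luc.
have : nbhs (1 : G) [set u | D (u * a ^+ p)].
  have : (fun u => u * a ^+ p) @ (1 : G) --> 1 * a ^+ p.
    by apply: (@cvg_mulg _ _ _ id (fun=> _)); [exact: cvg_id|exact: cvg_cst].
  by rewrite mul1g; apply.
move=> /nbhs1_sym[U [U1 UV UD]].
apply: SIN_conj => W W1.
have [H H1 HW] := FSIN_conj_translate G_FSIN U1 W1.
(* Since [u^-1 * a ^+ p] lies in [D], undoing the conjugation by [a ^+ p] leaves [h ^ u^-1] in [H],
   and [(h ^ u^-1) ^ (u * z) = h ^ z]. *)
have [H' H'1 H'H] := DH _ (nbhs1_conj (a ^+ p)^-1 H1).
exists H' => // h z H'h; have [u Uu uW] := HW z.
have /uW : H (h ^ u^-1).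
  have /= := H'H h (u^-1 * a ^+ p) H'h (UD _ (UV _ Uu)).
  by rewrite -conjgM mulgK.
by rewrite -conjgM mulKg.
Qed.
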